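(* Let $a\ge 2$, $c>0$, $d$ be integers with $d<ca$ and $\gcd(d,a)=\gcd(d,c)=1$, let $n\ge 1$, and let $\mathbf s_j=ca^{n+j}-d$ for $j\in\mathbb N$ and $S_n=\langle\{\mathbf s_j:j\in\mathbb N\}\rangle$. Suppose that $d>0$ and let $\lambda=\gcd(S_n)$. If $m$ is the smallest positive integer such that $\mathbf s_0/\lambda\le\mathbf R_m$, then $e(S_n)=m$.
   Context: $\mathbb N=\{0,1,2,\ldots\}$. For $A\subseteq\mathbb N$, $\langle A\rangle$ is the submonoid of $(\mathbb N,+)$ generated by $A$. For a nontrivial submonoid $M$ of $\mathbb N$, the minimal generating set of $M$ is the unique generating set contained in every generating set of $M$ (its elements are the nonzero elements of $M$ that are not sums of two nonzero elements of $M$; it is finite), and $e(M)$ is its cardinality. $\gcd(M)$ denotes the greatest common divisor of all elements of $M$. The repunit numbers in base $a$ are $\mathbf R_0=0$ and $\mathbf R_k=1+a+\cdots+a^{k-1}=(a^k-1)/(a-1)$ for $k\ge 1$. *)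

(* Defs.v *)
From HB Require Import structures.
From mathcomp Require Import all_boot all_order all_algebra finmap.
From mathcomp Require Import boolp classical_sets functions cardinality.

Set Implicit Arguments.
Unset Strict Implicit.
Unset Printing Implicit Defensive.

Import Order.TTheory GRing.Theory Num.Theory.

Local Open Scope classical_set_scope.

Definition submonoid (M : set nat) : Prop :=
  M 0%N /\ forall x y, M x -> M y -> M (x + y)%N.

Definition generated (A : set nat) : set nat := smallest submonoid A.

Definition is_min_gen_set (M A : set nat) : Prop :=
  generated A = M /\ forall B, generated B = M -> A `<=` B.

(* At most one [A] satisfies [is_min_gen_set M]. The default value [set0] has
   cardinality 0, so it cannot account for a positive [embdim M]. *)
Definition min_gen_set (M : set nat) : set nat :=
  xget set0 (is_min_gen_set M).

(* [fset_set] sends infinite sets to [fset0], so a positive value of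
   [embdim M] is the cardinality of a finite minimal generating set. *)
Definition embdim (M : set nat) : nat := #|` fset_set (min_gen_set M)|.

(* Greatest for divisibility; every set of naturals has exactly one such gcd,
   so the default value 0 is never used (it is the gcd of set0 and [set 0]). *)
Definition is_set_gcd (M : set nat) (g : nat) : Prop :=
  (forall x, M x -> g %| x)%N /\
  forall e, (forall x, M x -> e %| x)%N -> (e %| g)%N.

Definition set_gcd (M : set nat) : nat := xget 0%N (is_set_gcd M).

Local Open Scope ring_scope.

Definition repunit (a : int) (k : nat) : int := \sum_(i < k) a ^+ i.

Definition s_ (a c d : int) (n j : nat) : int := c * a ^+ (n + j) - d.

(* The elements [s_ a c d n j] are integers; when [d < c * a], [c > 0],
   [a >= 2] and [n >= 1] they are all positive, hence all of them are
   naturals and none is dropped here. *)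
Definition S_ (a c d : int) (n : nat) : set nat :=
  generated [set x : nat | exists j : nat, x%:Z = s_ a c d n j].

(* Main.v *)
Require Import Defs.
From mathcomp Require Import all_boot all_order all_algebra.
From mathcomp Require Import finmap boolp classical_sets functions cardinality.
From mathcomp Require Import zify ring.
Import Order.TTheory GRing.Theory Num.Theory.

Set Implicit Arguments.
Unset Strict Implicit.
Unset Printing Implicit Defensive.

(** With [E = (a - 1) c a^n] one has [s_j = s_0 + E R_j] and
    [lambda = gcd(s_0, E)].  Elements of [S_n] have the form [N s_0 + E P], and
    [s_k] being a sum of two nonzero ones forces [(N - 1) s_0 = E (R_k - P)] with
    [N >= 2], so that [s_0 / lambda] divides [R_k - P > 0]: this is impossible
    for [k < m].  Conversely [s_m = (1 + E / lambda) s_0 + E (R_m - s_0 / lambda)],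
    and the greedy expansion of [R_m - s_0 / lambda] in repunits has digit sum at
    most [a^(m-1) <= 1 + E / lambda], which puts [s_m] in [<s_0, ..., s_(m-1)>].
    The relation [s_(j+1) = a s_j + (a - 1) d] then propagates membership to
    all later generators. *)

Local Open Scope classical_set_scope.

(** * Generated submonoids and irreducible elements *)

Lemma generated_submonoid (A : set nat) : submonoid (generated A).
Proof.
split; first by move=> B [[B0 _] _].
by move=> x y Ax Ay B [BM AB]; apply: BM.2; [exact: Ax|exact: Ay].
Qed.

Lemma sub_generated (A : set nat) : A `<=` generated A.
Proof. exact: sub_gen_smallest. Qed.

Lemma generated_sub (A M : set nat) :
  submonoid M -> A `<=` M -> generated A `<=` M.
Proof. exact: smallest_sub. Qed.

Lemma generated_subset (A B : set nat) :
  A `<=` generated B -> generated A `<=` generated B.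
Proof. by move=> AB; apply: generated_sub => //; exact: generated_submonoid. Qed.

Lemma submonoid_muln (M : set nat) k x : submonoid M -> M x -> M (k * x)%N.
Proof.
move=> [M0 MD] Mx; elim: k => [|k IHk]; first by rewrite mul0n.
by rewrite mulSn; apply: MD.
Qed.

(** The elements that are zero, in [B], or a sum of two nonzero elements form a submonoid containing
    [B], hence exhaust [generated B]. *)
Lemma irreducible_in_generators (B : set nat) x :
  generated B x -> x <> 0%N ->
  (forall u v, generated B u -> generated B v -> u <> 0%N -> v <> 0%N ->
     x <> (u + v)%N) ->
  B x.
Proof.
move=> Bx x0 irr.
pose M y := generated B y /\ (y = 0%N \/ B y \/ exists u v,
  [/\ generated B u, generated B v, u <> 0%N, v <> 0%N & y = (u + v)%N]).
have [G0 GD] := generated_submonoid B.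
have MM : submonoid M.
  split=> [|y z [Gy My] [Gz Mz]]; first by split=> //; left.
  split; first exact: GD.
  have [y0|/eqP y0] := eqVneq y 0%N; first by rewrite y0 add0n.
  have [z0|/eqP z0] := eqVneq z 0%N; first by rewrite z0 addn0.
  by right; right; exists y, z.
have BM : B `<=` M.
  by move=> y By; split; [exact: sub_generated|right; left].
have [_ [//|[//|[u [v [Gu Gv u0 v0 xE]]]]]] := generated_sub MM BM Bx.
by case: (irr u v Gu Gv u0 v0 xE).
Qed.

Lemma min_gen_setE (M A : set nat) : is_min_gen_set M A -> min_gen_set M = A.
Proof.
move=> MA; apply: xget_unique => // B [GB minB].
by apply/seteqP; split; [exact: minB MA.1|exact: MA.2].
Qed.

Local Open Scope nat_scope.

(** * Repunits in [nat] and expansions in them *)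

Definition repn (a k : nat) : nat := \sum_(i < k) a ^ i.

Definition rep_term (a s E j : nat) : nat := s + E * repn a j.

Lemma repn0 a : repn a 0 = 0.
Proof. exact: big_ord0. Qed.

Lemma repnS a k : repn a k.+1 = a * repn a k + 1.
Proof.
rewrite /repn big_ord_recl expn0 addnC; congr (_ + _).
by rewrite big_distrr /=; apply: eq_bigr => i _; rewrite /bump expnS.
Qed.

Lemma repn_gt0 a k : 0 < k -> 0 < repn a k.
Proof. by case: k => // k _; rewrite repnS addn1. Qed.

Lemma repn_pred_expn a k : 0 < a -> (a - 1) * repn a k + 1 = a ^ k.
Proof.
move=> a0; elim: k => [|k IHk]; first by rewrite repn0 muln0.
rewrite repnS expnS -IHk; nia.
Qed.

Lemma ltn_repn a : 1 < a -> {homo repn a : i j / i < j}.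
Proof.
move=> a1; apply: homo_ltn => [? ? ?|k]; first exact: ltn_trans.
rewrite repnS; nia.
Qed.

(* The quotients of the greedy algorithm are the digits: each is at most [a],
   and once it equals [a] the remainder vanishes. *)
Lemma submonoid_repunit_expansion (M : set nat) a s E k N y :
  submonoid M -> 1 < a -> (forall i, i <= k -> M (rep_term a s E i)) ->
  a ^ k <= N -> y <= a * repn a k -> M (N * s + E * y).
Proof.
move=> MM a1; elim: k N y => [|k IHk] N y Mt leN ley.
  have -> : y = 0 by move: ley; rewrite repn0 muln0 leqn0 => /eqP.
  rewrite muln0 addn0; apply: submonoid_muln => //.
  by move: (Mt 0 isT); rewrite /rep_term repn0 muln0 addn0.
have r0 : 0 < repn a k.+1 by exact: repn_gt0.
have yE := divn_eq y (repn a k.+1).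
have lr := ltn_pmod y r0.
set q := y %/ _ in yE; set r := y %% _ in yE lr.
have ak0 : 0 < a ^ k by rewrite expn_gt0 ltnW.
have qa : q <= a by nia.
suff [qN Mr] : q <= N /\ M ((N - q) * s + E * r).
  have -> : N * s + E * y = q * rep_term a s E k.+1 + ((N - q) * s + E * r).
    rewrite yE /rep_term -{1}(subnK qN); ring.
  by apply: MM.2 => //; apply: submonoid_muln => //; exact: Mt.
have [aq|qa'] := leqP a q.
  have -> : r = 0 by nia.
  rewrite muln0 addn0; split; first by apply: leq_trans leN; rewrite expnS; nia.
  apply: submonoid_muln => //.
  by move: (Mt 0 isT); rewrite /rep_term repn0 muln0 addn0.
(* Here [q <= a - 1 <= (a - 1) * a ^ k = a ^ k.+1 - a ^ k], so at least [a ^ k] copies of [s] remain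
   for the lower digits. *)
have qN : q + a ^ k <= N by apply: leq_trans leN; rewrite expnS; nia.
split; first lia.
apply: IHk; first by move=> i ik; apply: Mt; exact: leqW.
  lia.
(* A remainder below [repn a k.+1 = a * repn a k + 1] meets exactly the bound of the induction. *)
by move: lr; rewrite repnS; lia.
Qed.

(** * Generation by the first [m] terms *)

Lemma rep_term_in_lower (M : set nat) a s E m :
  submonoid M -> 1 < a -> 0 < s -> (a - 1) * s <= E -> 0 < m ->
  s <= gcdn s E * repn a m -> gcdn s E * repn a m.-1 < s ->
  (forall i, i < m -> M (rep_term a s E i)) -> M (rep_term a s E m).
Proof.
move=> MM a1 s0 leE; case: m => // k _ le_s lt_s Mt; rewrite /= in lt_s.
have g0 : 0 < gcdn s E by rewrite gcdn_gt0 s0.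
have /dvdnP [s' sE] := dvdn_gcdl s E.
have /dvdnP [E' EE] := dvdn_gcdr s E.
move: g0 sE EE le_s lt_s; move: (gcdn s E) => g g0 sE EE le_s lt_s.
have le_s' : s' <= repn a k.+1 by nia.
have lt_s' : repn a k < s' by nia.
have leE' : (a - 1) * s' <= E'.
  by move: leE; rewrite sE EE mulnA leq_pmul2r.
have -> : rep_term a s E k.+1 = (1 + E') * s + E * (repn a k.+1 - s').
  rewrite /rep_term mulnBr sE EE.
  have : E' * g * s' <= E' * g * repn a k.+1 by rewrite leq_mul2l le_s' orbT.
  nia.
apply: (@submonoid_repunit_expansion M a s E k) => //.
  (* [a ^ k = (a - 1) * repn a k + 1 <= (a - 1) * s' + 1 <= E' + 1], by [lt_s'] and [leE']. *)
  rewrite -repn_pred_expn 1?ltnW //; nia.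
rewrite repnS; lia.
Qed.

(** In the application [E - (a - 1) * s] is [(a - 1) * d]: the sign of [d] enters as
    [(a - 1) * s <= E]. *)
Lemma rep_term_rec a s E j : (a - 1) * s <= E -> 0 < a ->
  rep_term a s E j.+1 = a * rep_term a s E j + (E - (a - 1) * s).
Proof. by move=> leE a0; rewrite /rep_term repnS; nia. Qed.

Lemma generated_rep_term a s E m :
  1 < a -> 0 < s -> (a - 1) * s <= E -> 0 < m ->
  s <= gcdn s E * repn a m -> gcdn s E * repn a m.-1 < s ->
  forall j, generated (rep_term a s E @` `I_m)%classic (rep_term a s E j).
Proof.
move=> a1 s0 leE m0 le_s lt_s.
set M := generated _.
have MM : submonoid M by exact: generated_submonoid.
have [M0 MD] := MM.
have Mlt i : i < m -> M (rep_term a s E i).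
  by move=> im; apply: sub_generated; exists i.
have Mle i : i < m -> M (rep_term a s E i.+1).
  rewrite leq_eqVlt => /orP[/eqP ->|]; last exact: Mlt.
  exact: (rep_term_in_lower MM a1 s0 leE m0 le_s lt_s Mlt).
pose D := E - (a - 1) * s.
(* The map from [x] to [a * x + D] sends each term to the next. Zero is set apart because [D] itself
   need not lie in [M]. *)
pose P x := M x /\ (x = 0 \/ M (a * x + D)).
have PM : submonoid P.
  split=> [|x y [Mx xP] [My yP]]; first by split=> //; left.
  split; first exact: MD.
  have [x0|Mx'] := xP; first by rewrite x0 add0n.
  right; rewrite mulnDr addnAC; apply: MD => //.
  exact: (submonoid_muln a MM My).
have MP : (M `<=` P)%classic.
  apply: generated_sub => // _ [i im <-]; split; first exact: Mlt.
  by right; rewrite /D -rep_term_rec ?(ltnW a1) //; exact: Mle.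
elim=> [|j IHj]; first exact: Mlt.
rewrite rep_term_rec ?(ltnW a1) //.
by have [_ [|//]] := MP _ IHj; rewrite /rep_term; lia.
Qed.

(** * Irreducibility of the first terms, embedding dimension and gcd *)

Lemma rep_term_sum a s E k u v :
  0 < s ->
  generated (range (rep_term a s E)) u -> generated (range (rep_term a s E)) v ->
  u <> 0 -> v <> 0 -> rep_term a s E k = u + v -> s <= gcdn s E * repn a k.
Proof.
move=> s0 Gu Gv u0 v0 tE.
pose P x := x = 0 \/ exists N Q, 0 < N /\ x = N * s + E * Q.
have PM : submonoid P.
  split=> [|x y]; first by left.
  move=> [->//|[N [Q [N0 xE]]]] [->|[N' [Q' [N'0 yE]]]].
    by rewrite addn0; right; exists N, Q.
  by right; exists (N + N'), (Q + Q'); split; [lia|rewrite xE yE; ring].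
have GP : (generated (range (rep_term a s E)) `<=` P)%classic.
  apply: generated_sub => // _ [j _ <-]; right; exists 1, (repn a j).
  by rewrite mul1n.
have [//|[N [Q [N0 uE]]]] := GP _ Gu.
have [//|[N' [Q' [N'0 vE]]]] := GP _ Gv.
have eqE : (N + N' - 1) * s = E * (repn a k - (Q + Q')).
  by move: tE; rewrite /rep_term uE vE; nia.
set X := repn a k - _ in eqE.
(* As [N + N' >= 2], the left side of [eqE] is positive. *)
have X0 : 0 < X by case: X eqE => //; nia.
(* [s] divides [s * X] and, by [eqE], also [E * X], hence their gcd. *)
have sX : s %| gcdn s E * X.
  by rewrite muln_gcdl dvdn_gcd dvdn_mulr // -eqE dvdn_mull.
have g0 : 0 < gcdn s E by rewrite gcdn_gt0 s0.
apply: leq_trans (dvdn_leq _ sX) _; first by rewrite muln_gt0 g0.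
by rewrite leq_mul2l leq_subr orbT.
Qed.

Lemma embdim_rep_term a s E m :
  1 < a -> 0 < s -> (a - 1) * s <= E -> 0 < m ->
  s <= gcdn s E * repn a m ->
  (forall k, 0 < k -> s <= gcdn s E * repn a k -> m <= k) ->
  embdim (generated (range (rep_term a s E))) = m.
Proof.
move=> a1 s0 leE m0 le_s minm.
have lt_s k : k < m -> gcdn s E * repn a k < s.
  move=> km; rewrite ltnNge; apply/negP => le_sk.
  (* Minimality of [m] only concerns positive [k]; for [k = 0] the repunit vanishes while
     [s > 0]. *)
  have [k0|k0] := posnP k; last by move: (minm k k0 le_sk); lia.
  by move: le_sk; rewrite k0 repn0 muln0; lia.
have Gt := generated_rep_term a1 s0 leE m0 le_s (lt_s m.-1 ltac:(lia)).
have GE : generated (range (rep_term a s E)) =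
    generated (rep_term a s E @` `I_m)%classic.
  apply/seteqP; split; apply: generated_subset.
    by move=> _ [j _ <-].
  by move=> _ [j _ <-]; apply: sub_generated; exists j.
have E0 : 0 < E by nia.
rewrite /embdim (@min_gen_setE _ (rep_term a s E @` `I_m)%classic).
  apply: card_fset_set; apply: inj_card_eq => i j _ _ /eqP.
  rewrite /rep_term eqn_add2l eqn_pmul2l //.
  by move=> /eqP /(incn_inj (leq_mono (ltn_repn a1))).
split=> // B BE _ [k /= km <-].
apply: irreducible_in_generators; rewrite ?BE.
- by apply: sub_generated; exists k.
- by rewrite /rep_term; lia.
- move=> u v Gu Gv u0 v0 tE.
  by move: (lt_s k km); rewrite ltnNge (rep_term_sum s0 Gu Gv u0 v0 tE).
Qed.

(** The first two terms, [s] and [s + E], already determine the gcd. *)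
Lemma set_gcd_rep_term a s E :
  set_gcd (generated (range (rep_term a s E))) = gcdn s E.
Proof.
pose t := rep_term a s E.
have gen j : generated (range t) (t j) by apply: sub_generated; exists j.
have gcdP : is_set_gcd (generated (range t)) (gcdn s E).
  split=> [x Gx|e eP].
    have dM : submonoid [set x | gcdn s E %| x]%classic.
      by split=> [|? ?]; [exact: dvdn0|exact: dvdn_add].
    apply: (generated_sub dM) Gx => _ [j _ <-].
    by rewrite /= /t /rep_term dvdn_add ?dvdn_gcdl // dvdn_mulr // dvdn_gcdr.
  have es : e %| s.
    by move: (eP _ (gen 0)); rewrite /t /rep_term repn0 muln0 addn0.
  rewrite dvdn_gcd es /= -(dvdn_addr E es).
  by move: (eP _ (gen 1)); rewrite /t /rep_term /repn big_ord1 muln1.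
apply: xget_unique => // h [hl hg].
by apply/eqP; rewrite eqn_dvd gcdP.2 //= hg //; exact: gcdP.1.
Qed.

Local Open Scope ring_scope.

Theorem proposition3p10 (a c d : int) (n lambda m : nat)
  (ha : 2 <= a) (hc : 0 < c) (hdca : d < c * a)
  (hda : gcdz d a = 1) (hdc : gcdz d c = 1)
  (hn : (1 <= n)%N)
  (hd : 0 < d)
  (hlambda : lambda = set_gcd (S_ a c d n))
  (hm_pos : (0 < m)%N)
  (hm : (s_ a c d n 0)%:Q / lambda%:Q <= (repunit a m)%:Q)
  (hm_min : forall k : nat, (0 < k)%N ->
     (s_ a c d n 0)%:Q / lambda%:Q <= (repunit a k)%:Q -> (m <= k)%N) :
  embdim (S_ a c d n) = m.
Proof.
case: a ha hdca hda hlambda hm hm_min => // a ha hdca _ hlambda hm hm_min.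
case: c hc hdca hdc hlambda hm hm_min => // c hc hdca _ hlambda hm hm_min.
case: d hd hdca hlambda hm hm_min => // d hd hdca hlambda hm hm_min.
pose s := (c * a ^ n - d)%N; pose E := ((a - 1) * (c * a ^ n))%N.
have a1 : (1 < a)%N by [].
(* Since [n >= 1], [d < c * a <= c * a ^ n], so the truncated subtraction in [s] is exact. *)
have ds : (d < c * a ^ n)%N.
  apply: (@leq_trans (c * a)%N); first by move: hdca; lia.
  by rewrite leq_mul2l -{1}(expn1 a) leq_exp2l // hn orbT.
have termE j : s_ a c d n j = (rep_term a s E j)%:Z.
  have jE := repn_pred_expn j (ltnW a1).
  have : (c * a ^ (n + j) = d + rep_term a s E j)%N.
    rewrite /rep_term /s /E expnD -jE; nia.
  rewrite /s_ -(rmorphXn Posz) natrXE -PoszM => ->.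
  by rewrite PoszD addrC addKr.
have SE : S_ a c d n = generated (range (rep_term a s E)).
  congr generated; apply/seteqP; split=> x /=.
    by move=> [j]; rewrite termE => -[->]; exists j.
  by move=> [j _ <-]; exists j; rewrite termE.
have s0 : (0 < s)%N by rewrite subn_gt0.
have g0 : (0 < gcdn s E)%N by rewrite gcdn_gt0 s0.
have repunitE k : repunit a k = (repn a k)%:Z.
  rewrite /repunit /repn (raddf_sum Posz); apply: eq_bigr => i _.
  by rewrite -(rmorphXn Posz).
(* Clearing the positive denominator [lambda] turns the rational inequality into one in [nat]. *)
have leE k : ((s_ a c d n 0)%:Q / lambda%:Q <= (repunit a k)%:Q)
    = (s <= gcdn s E * repn a k)%N.
  rewrite hlambda SE set_gcd_rep_term termE repunitE.
  rewrite ler_pdivrMr ?ltr0z // -intrM ler_int -PoszM lez_nat mulnC.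
  by rewrite /rep_term repn0 muln0 addn0.
rewrite SE; apply: embdim_rep_term => //.
- by rewrite leq_mul2l leq_subr orbT.
- by rewrite -leE.
- by move=> k k0; rewrite -leE; exact: hm_min.
Qed.
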